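(* Let $\mathbb{R}^n$ be equipped with a norm with closed unit ball $\mathbf{B}$, and suppose that this Minkowski space satisfies the following Lens Cutting Condition: for any two distinct points $u,v\in\mathbb{R}^n$ with $d_{\mathbf{B}}(u,v)\le 1$, any $x\in\mathbb{S}(u)\cap\mathbb{S}(v)$ and any $\varepsilon>0$, there is a $w\in\mathbb{R}^n$ such that $x\notin\mathbf{B}(w)$ but $\mathbf{B}(w)\supset(\mathbf{B}(u)\cap\mathbf{B}(v))\setminus(x+\varepsilon\mathbf{B})$. Let $k$ be a positive integer, and let $S\subset\mathbb{R}^n$ be a closed set of positive diameter that is a set of unique completion, with completion $C$. Then any $k$-fold Borsuk covering of $S$ extends to a $k$-fold Borsuk covering of $C$.
   Context: A Minkowski space is a finite-dimensional real normed space; $d_{\mathbf{B}}(x,y)$ denotes the distance in the norm with closed unit ball $\mathbf{B}$, $\mathbf{B}(x)=x+\mathbf{B}$ is the closed unit ball centered at $x$, and $\mathbb{S}(x)$ is its boundary (the unit sphere centered at $x$). Diameters are taken with respect to this norm. A bounded set $C$ is complete if no set of the same diameter properly contains $C$. A bounded set $S$ is a set of unique completion if there is a unique complete set $C$ containing $S$ and having the same diameter as $S$; this $C$ is the completion of $S$. A $k$-fold Borsuk covering of a set $S$ of diameter $d>0$ is a finite (indexed) family of subsets of $S$, each of diameter strictly less than $d$, such that every point of $S$ belongs to at least $k$ members of the family. A $k$-fold Borsuk covering $\{Q_1,\dots,Q_m\}$ of $S$ extends to a $k$-fold Borsuk covering of a set $C\supseteq S$ of the same diameter if there is a $k$-fold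 Borsuk covering $\{Q_1',\dots,Q_m'\}$ of $C$ with $Q_i\subseteq Q_i'$ for every $i$. *)

(* Defs.v *)
From HB Require Import structures.
From mathcomp Require Import all_boot all_order all_algebra.
From mathcomp Require Import all_classical all_reals all_analysis.

Set Implicit Arguments.
Unset Strict Implicit.
Unset Printing Implicit Defensive.

Import Order.TTheory GRing.Theory Num.Theory.
Import numFieldNormedType.Exports.

Local Open Scope classical_set_scope.
Local Open Scope ring_scope.

(* MathComp-Analysis. A Minkowski space is 'rV[R]_n together with an arbitrary
   norm N. The library's own norm on 'rV[R]_n (the sup norm) is used only
   through its topology, which is the one defined by N because the dimension
   is finite; it occurs in [closed], [closure] and [interior]. *)

Record is_norm (R : realType) (n : nat) (N : 'rV[R]_n -> R) : Prop := IsNorm {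
  norm_triangle : forall x y, N (x + y) <= N x + N y;
  norm_homog : forall (a : R) x, N (a *: x) = `|a| * N x;
  norm_definite : forall x, N x = 0 -> x = 0
}.

Section Minkowski.
Context {R : realType} {n : nat}.
Variable N : 'rV[R]_n -> R.
Implicit Types (x y u v w : 'rV[R]_n) (A C D S : set 'rV[R]_n).

Definition dist x y : R := N (x - y).

Definition unit_ball : set 'rV[R]_n := [set b | N b <= 1].

(* x + e B; the closed unit ball centred at x is the case e = 1. *)
Definition hball x (e : R) : set 'rV[R]_n := [set x + e *: b | b in unit_ball].

Definition ball1 x : set 'rV[R]_n := hball x 1.

Definition sphere1 x : set 'rV[R]_n := closure (ball1 x) `\` interior (ball1 x).

Definition norm_bounded A : Prop := exists r : R, forall x, A x -> N x <= r.

(* Extended-real valued: +oo on unbounded sets, 0 on the empty set. *)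
Definition diam A : \bar R :=
  maxe 0%E (ereal_sup [set (dist x y)%:E | x in A & y in A]).

Definition complete_set C : Prop :=
  norm_bounded C /\ ~ (exists D, C `<` D /\ diam D = diam C).

Definition completion S C : Prop :=
  [/\ complete_set C, S `<=` C & diam C = diam S].

Definition unique_completion S : Prop :=
  norm_bounded S /\ exists! C, completion S C.

Definition lens_cutting : Prop :=
  forall u v x (e : R), u <> v -> dist u v <= 1 ->
  (sphere1 u `&` sphere1 v) x -> 0 < e ->
  exists w, ~ ball1 w x /\ (ball1 u `&` ball1 v) `\` hball x e `<=` ball1 w.

(* For S of positive diameter. The family is indexed, so equal members at
   different indices count separately towards the multiplicity. *)
Definition borsuk_covering (k : nat) S (m : nat) (Q : 'I_m -> set 'rV[R]_n) :
    Prop :=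
  [/\ forall i, Q i `<=` S,
      forall i, (diam (Q i) < diam S)%E
    & forall x, S x -> (k <= #|[pred i | x \in Q i]|)%N].

Definition covering_extends (k : nat) C (m : nat) (Q : 'I_m -> set 'rV[R]_n) :
    Prop :=
  exists Q' : 'I_m -> set 'rV[R]_n,
    borsuk_covering k C Q' /\ forall i, Q i `<=` Q' i.

End Minkowski.

(* Main.v *)
(** Write d = diam S. Unique completion forces C to be the intersection of the
    balls of radius d centred at S. Call x, y in C antipodal if they are at
    distance d. By the Lens Cutting Condition a point of C outside S has at
    most one antipode in C; and a point of C that has an antipode in C also has
    one in S, since otherwise it could be moved away from its antipode inside C.

    Hence no two points of C outside S are antipodal. If x in C \ S has
    antipode y, and z in S is an antipode of y, then the (at least k) members
    of the covering that contain z stay away from y, hence at distance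
    uniformly less than d from x, so x can be added to each of them.
    Compactness makes these gaps uniform once a small neighbourhood of S has
    been absorbed by enlarging the members slightly. *)
Require Import Defs.
From HB Require Import structures.
From mathcomp Require Import all_boot all_order all_algebra.
From mathcomp Require Import all_classical all_reals all_analysis.
From mathcomp Require Import lra.

Set Implicit Arguments.
Unset Strict Implicit.
Unset Printing Implicit Defensive.

Import Order.TTheory GRing.Theory Num.Theory.
Import numFieldNormedType.Exports.

Local Open Scope classical_set_scope.
Local Open Scope ring_scope.

Section Norm.
Context (R : realType) (n : nat) (N : 'rV[R]_n -> R) (hN : is_norm N).
Implicit Types (x y z u v w : 'rV[R]_n) (A B K S C : set 'rV[R]_n) (d e r : R).

(** * Arbitrary norms: continuity and comparison with the sup norm *)

Lemma is_norm0 : N 0 = 0.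
Proof. by rewrite -(scale0r 0) norm_homog// normr0 mul0r. Qed.

Lemma is_normN x : N (- x) = N x.
Proof. by rewrite -scaleN1r norm_homog// normrN1 mul1r. Qed.

Lemma is_norm_subC x y : N (x - y) = N (y - x).
Proof. by rewrite -is_normN opprB. Qed.

Lemma is_norm_ge0 x : 0 <= N x.
Proof.
have := norm_triangle hN x (- x); rewrite subrr is_norm0 is_normN.
by rewrite -mulr2n pmulrn_lge0.
Qed.

Lemma is_norm_sub_triangle z x y : N (x - y) <= N (x - z) + N (z - y).
Proof. by rewrite -[x - y](subrKA z) norm_triangle. Qed.

Lemma is_norm_upper : exists2 M, 0 < M & forall x, N x <= M * `|x|.
Proof.
(* The added 1 keeps the factor positive even when [n] is 0. *)
exists (1 + \sum_(j < n) N (delta_mx 0 j)).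
  by rewrite ltr_wpDr// sumr_ge0// => j _; exact: is_norm_ge0.
move=> x; apply: (@le_trans _ _ (\sum_(j < n) N (delta_mx 0 j) * `|x|)); last first.
  by rewrite -mulr_suml ler_wpM2r// lerDr.
rewrite [x in N x]row_sum_delta.
elim/big_ind2 : _ => [|a b a' b' ha hb|j _]; first by rewrite is_norm0.
  by rewrite (le_trans (norm_triangle hN _ _))// lerD.
rewrite norm_homog// mulrC ler_wpM2l ?is_norm_ge0//.
by rewrite [leRHS]/Num.Def.normr /= mx_normrE; apply/bigmax_geP; right => /=; exists (0, j).
Qed.

Lemma is_norm_continuous : continuous N.
Proof.
have [M M0 hM] := is_norm_upper.
move=> x; apply/(@cvgrPdist_le _ _ _ (nbhs x)) => e e0.
have : \forall y \near x, `|x - y| <= e / M.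
  have /cvgrPdist_le : id @ nbhs x --> x by exact: cvg_id.
  by apply; rewrite divr_gt0.
apply: filterS => y hy.
have hxy : N (x - y) <= e.
  by rewrite (le_trans (hM _))// mulrC -ler_pdivlMr.
have := norm_triangle hN (x - y) y; have := norm_triangle hN (y - x) x.
rewrite !subrK (is_norm_subC y x) ler_distl => h1 h2; lra.
Qed.

(** [N] attains a positive minimum on the sup-norm unit sphere if that is nonempty; homogeneity does
    the rest. *)
Lemma is_norm_lower : exists2 c, 0 < c & forall x, c * `|x| <= N x.
Proof.
pose A := [set x : 'rV[R]_n | `|x| = 1].
have normalize x : x != 0 -> A (`|x|^-1 *: x).
  by move=> x0; rewrite /A/= normrZ normfV normr_id mulVf// normr_eq0.
have [A0|A0] := pselect (A !=set0); last first.
  exists 1 => // x; have [->|x0] := eqVneq x 0; first by rewrite normr0 mulr0 is_norm_ge0.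
  by exfalso; apply: A0; exists (`|x|^-1 *: x); exact: normalize.
have cA : compact A.
  apply: bounded_closed_compact.
    by exists 1; split => // y y1 x /= ->; exact: ltW.
  have -> : A = (@Num.Def.normr R 'rV[R]_n) @^-1` [set 1] by [].
  by apply: closed_comp; [move=> x _; exact: norm_continuous|exact: closed_eq].
have [a aA amin] := EVT_min_rV A0 cA (continuous_subspaceT is_norm_continuous).
have Na : 0 < N a.
  rewrite lt_neqAle is_norm_ge0 andbT eq_sym; apply/eqP => /(norm_definite hN) a0.
  by move: aA; rewrite a0 inE /A/= normr0 => /esym/eqP; rewrite oner_eq0.
exists (N a) => // x; have [->|x0] := eqVneq x 0; first by rewrite normr0 mulr0 is_norm_ge0.
have := amin (`|x|^-1 *: x); rewrite inE => /(_ (normalize _ x0)).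
by rewrite norm_homog// normfV normr_id mulrC ler_pdivlMr// normr_gt0.
Qed.

Lemma closed_norm_bounded_compact A : closed A -> norm_bounded N A -> compact A.
Proof.
move=> cA [r hr]; apply: bounded_closed_compact => //.
have [c c0 hc] := is_norm_lower.
exists (r / c); split; [exact: num_real|] => y ry x Ax /=.
by apply: le_trans (ltW ry); rewrite ler_pdivlMr// mulrC (le_trans (hc _))// hr.
Qed.

Lemma is_norm_sub_continuous x : continuous (fun y => N (y - x)).
Proof.
move=> y; apply: (@continuous_comp _ _ _ (fun y => y - x) N); last exact: is_norm_continuous.
by apply: (@continuousB _ _ _ id (cst x)); [exact: cvg_id|exact: cst_continuous].
Qed.

Lemma near_norm_lt x e : 0 < e -> \forall y \near x, N (y - x) < e.
Proof.
move=> e0; apply: (@cvgr_lt _ _ (nbhs x) _ (fun y => N (y - x)) (N (x - x))); first exact: is_norm_sub_continuous.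
by rewrite subrr is_norm0.
Qed.

Lemma closed_norm_ball x d : closed [set y | N (y - x) <= d].
Proof.
apply: (@closed_comp _ _ (fun y => N (y - x)) [set t : R | t <= d]); last exact: closed_le.
by move=> y _; exact: is_norm_sub_continuous.
Qed.

Lemma closed_norm_ballC x d : closed [set y | d <= N (y - x)].
Proof.
apply: (@closed_comp _ _ (fun y => N (y - x)) [set t : R | d <= t]); last exact: closed_ge.
by move=> y _; exact: is_norm_sub_continuous.
Qed.

(** * Uniform gaps on compact sets *)

(** A gap [e] at [x] leaves a gap [e / 2] at all points closer than [e / 2] to [x], with the same
    index [i]. Compactness then gives one gap for all of [K], while [i] may still vary. *)
Lemma compact_uniform_gap (I : Type) (D : set I) (T : I -> set 'rV[R]_n) K d :
  compact K ->
  (forall x, K x -> exists i e, [/\ D i, 0 < e & forall q, T i q -> N (x - q) <= d - e]) ->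
  exists2 e, 0 < e &
    forall x, K x -> exists2 i, D i & forall q, T i q -> N (x - q) <= d - e.
Proof.
move=> /compact_near_coveringP cK h.
have : \forall e \near (0:R)^'+, K `<=` (fun x => exists2 i, D i & forall q, T i q -> N (x - q) <= d - e).
  apply: cK => x /h[i [e [Di e0 he]]].
  exists ([set y | N (y - x) < e / 2], [set t | t <= e / 2]).
    by split => /=; [apply: near_norm_lt; lra|apply: nbhs_right_le; lra].
  move=> [y t] /= [hy ht]; exists i => // q /he.
  have := is_norm_sub_triangle x y q; lra.
move=> h1.
have : \forall e \near (0:R)^'+, 0 < e /\ K `<=` (fun x => exists2 i, D i & forall q, T i q -> N (x - q) <= d - e).
  by apply: filterI => //; exact: nbhs_right_gt.
by move=> /filter_ex[e [e0 he]]; exists e.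
Qed.

Lemma compact_point_gap K z d : compact K -> (forall x, K x -> N (x - z) < d) ->
  exists2 e, 0 < e & forall x, K x -> N (x - z) <= d - e.
Proof.
move=> cK h.
have [|e e0 he] := @compact_uniform_gap unit setT (fun=> [set z]) K d cK.
  move=> x /h xz; exists tt, (d - N (x - z)); split => //; first lra.
  by move=> q ->; lra.
by exists e => // x /he[_ _]; exact.
Qed.

(** Compactness is used twice: for the second point with the first one fixed, then for the first. *)
Lemma compact_diam_gap K d : compact K ->
  (forall x y, K x -> K y -> N (x - y) < d) ->
  exists2 e, 0 < e & forall x y, K x -> K y -> N (x - y) <= d - e.
Proof.
move=> cK h.
have [|e e0 he] := @compact_uniform_gap unit setT (fun=> K) K d cK.
  move=> x Kx; have [e e0 he] := @compact_point_gap K x d cK (fun y Ky => h y x Ky Kx).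
  by exists tt, e; split => // q /he; rewrite is_norm_subC.
by exists e => // x y /he[_ _]; exact.
Qed.

(** * Diameters as real bounds *)

Lemma diam_leP A d : 0 <= d ->
  (diam N A <= d%:E)%E <-> forall x y, A x -> A y -> N (x - y) <= d.
Proof.
move=> d0; rewrite /diam ge_max lee_fin d0 /=; split.
  move=> h x y Ax Ay; rewrite -lee_fin (le_trans _ h)//.
  by apply: ereal_sup_ubound; exists x => //; exists y.
by move=> h; apply: ge_ereal_sup => _ [x Ax [y Ay <-]]; rewrite lee_fin h.
Qed.

Lemma diam_ltP A d : 0 < d -> (diam N A < d%:E)%E <->
  exists2 e, 0 < e & forall x y, A x -> A y -> N (x - y) <= d - e.
Proof.
move=> d0; split.
  have D0 : (0 <= diam N A)%E by rewrite /diam le_max lexx.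
  move=> Ad; have Afin : diam N A \is a fin_num.
    by rewrite ge0_fin_numE// (lt_trans Ad)// ltry.
  exists (d - fine (diam N A)).
    by rewrite subr_gt0 -lte_fin fineK.
  by rewrite opprB addrC subrK; apply/diam_leP; rewrite ?fine_ge0 ?fineK.
(* [d - e] may be negative when [A] is empty, whereas [diam] never is. *)
move=> [e e0 he]; apply: (@le_lt_trans _ _ (Num.max 0 (d - e))%:E).
  by apply/diam_leP; [rewrite le_max lexx|move=> x y Ax Ay; rewrite le_max he// orbT].
by rewrite lte_fin gt_max d0 ltrBlDr ltrDl.
Qed.

Lemma norm_bounded_diam A : norm_bounded N A -> (diam N A < +oo)%E.
Proof.
move=> [r hr]; apply: (@le_lt_trans _ _ (`|r| + `|r|)%:E); last exact: ltry.
apply/diam_leP => [|x y Ax Ay]; first by rewrite addr_ge0.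
rewrite (le_trans (norm_triangle hN _ _))// is_normN.
by rewrite lerD// (le_trans (hr _ _))// ler_norm.
Qed.

(** * Balls, spheres and lens cutting at radius [d] *)

Lemma ball1E x : ball1 N x = [set p | N (p - x) <= 1].
Proof.
apply/seteqP; split => p /=.
  by move=> [b /= b1 <-]; rewrite scale1r addrAC subrr add0r.
by move=> h; exists (p - x) => //; rewrite scale1r addrC subrK.
Qed.

Lemma hballE x e : 0 < e -> hball N x e = [set p | N (p - x) <= e].
Proof.
move=> e0; apply/seteqP; split => p /=.
  move=> [b /= b1 <-]; rewrite addrAC subrr add0r norm_homog// gtr0_norm//.
  by rewrite -[leRHS]mulr1 ler_wpM2l// ltW.
move=> h; exists (e^-1 *: (p - x)).
  by rewrite /unit_ball/= norm_homog// gtr0_norm ?invr_gt0// mulrC ler_pdivrMr// mul1r.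
by rewrite scalerA divff ?gt_eqF// scale1r addrC subrK.
Qed.

(** Moving from [x] in the direction [x - u] leaves the ball at once, so [x] is not interior. *)
Lemma sphere1_dist u x : N (x - u) = 1 -> sphere1 N u x.
Proof.
move=> xu; rewrite /sphere1 ball1E; split; first by apply: subset_closure; rewrite /= xu.
rewrite /interior /= => hx.
have h : (fun t : R => x + t *: (x - u)) @ (0:R)^'+ --> x.
  rewrite -[X in _ --> X]addr0 -(scale0r (x - u)).
  apply: cvgD; first exact: cvg_cst.
  by apply: cvgZr_tmp; apply: cvg_at_right_filter; exact: cvg_id.
have : \forall t \near (0:R)^'+, 0 < t /\ N (x + t *: (x - u) - u) <= 1.
  by apply: filterI; [exact: nbhs_right_gt|exact: (h _ hx)].
move=> /filter_ex[t [t0]].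
rewrite addrAC -[X in X + _]scale1r -scalerDl norm_homog// xu mulr1.
by rewrite gtr0_norm; lra.
Qed.

(** The homothety of ratio [d^-1] reduces this to unit balls. *)
Lemma lens_cutting_scale u v x d e : lens_cutting N -> 0 < d -> 0 < e ->
  u <> v -> N (u - v) <= d -> N (x - u) = d -> N (x - v) = d ->
  exists2 w, d < N (x - w) &
    forall p, N (p - u) <= d -> N (p - v) <= d -> e < N (p - x) -> N (p - w) <= d.
Proof.
move=> hlens d0 e0 uv uvd xu xv.
have d'0 : 0 < d^-1 by rewrite invr_gt0.
have dE a b : N (d^-1 *: a - d^-1 *: b) = N (a - b) / d.
  by rewrite -scalerBr norm_homog// gtr0_norm// mulrC.
have [||||w []] := hlens (d^-1 *: u) (d^-1 *: v) (d^-1 *: x) (e / d).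
- by move=> /scalerI; rewrite gt_eqF// => /(_ isT).
- by rewrite /dist dE ler_pdivrMr// mul1r.
- by split; apply: sphere1_dist; rewrite dE ?xu ?xv divff ?gt_eqF.
- by rewrite divr_gt0.
have -> : w = d^-1 *: (d *: w) by rewrite scalerA mulVf ?gt_eqF// scale1r.
rewrite !ball1E hballE ?divr_gt0// => xw hw; exists (d *: w).
  by move: xw => /negP; rewrite /= dE ler_pdivrMr// mul1r -ltNge.
move=> p pu pv px; have := hw (d^-1 *: p); rewrite /= !dE !ler_pdivrMr// mul1r.
by apply; split => //; rewrite -mulrA mulVf ?gt_eqF// mulr1; apply/negP; rewrite -ltNge.
Qed.

(** * Completions *)

Lemma le_diam A B : A `<=` B -> (diam N A <= diam N B)%E.
Proof.
move=> AB; rewrite /diam ge_max !le_max lexx/=; apply/orP; right.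
by apply: ereal_sup_le => _ [x /AB Bx [y /AB By <-]]; exists x => //; exists y.
Qed.

Lemma exists_completion A d : A !=set0 -> 0 <= d -> diam N A = d%:E ->
  exists M, completion N A M.
Proof.
move=> [a Aa] d0 diamA.
(* Forming the union with [A] inside [P], instead of requiring [M] to contain [A], lets the union of
   the empty chain satisfy [P]. *)
pose P := [set M | forall x y, (M `|` A) x -> (M `|` A) y -> N (x - y) <= d].
have Ad : forall x y, A x -> A y -> N (x - y) <= d.
  by apply/diam_leP => //; rewrite diamA.
have [F FP Ftot|M [PM Mmax]] := @Zorn_bigcup _ P.
  move=> x y [[X FX Xx]|Ax] [[Y FY Yy]|Ay].
  - have [XY|YX] := Ftot _ _ FX FY.
      by apply: (FP _ FY); left => //; exact: XY.
    by apply: (FP _ FX); left => //; exact: YX.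
  - by apply: (FP _ FX); [left|right].
  - by apply: (FP _ FY); [right|left].
  - exact: Ad.
have diamM : diam N (M `|` A) = d%:E.
  apply/eqP; rewrite eq_le -{2}diamA le_diam ?andbT; last exact: subsetUr.
  exact/diam_leP.
exists (M `|` A); split; [split| |by rewrite diamM diamA].
- exists (d + N a) => x Mx; have := norm_triangle hN (x - a) a; rewrite subrK.
  by have := PM x a Mx (or_intror Aa); lra.
- move=> [D [[MD DM] diamD]].
  have MD' : M `<=` D by move=> x Mx; apply: MD; left.
  have AD : D `|` A = D by apply/setUidPl => x Ax; apply: MD; right.
  apply: (Mmax D); first by split => // DM'; apply: DM => x /DM'; left.
  by move=> x y; rewrite AD; move: x y; apply/diam_leP => //; rewrite diamD diamM.
- exact: subsetUr.
Qed.

(* Adjoining to S a point within distance d of S does not increase the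
   diameter, so such a point lies in some completion of S, which must be C. *)
Lemma unique_completion_hull S C d p : 0 <= d -> diam N S = d%:E ->
  unique_completion N S -> completion N S C ->
  (forall s, S s -> N (p - s) <= d) -> C p.
Proof.
move=> d0 diamS [_ [C' [_ uniqC']]] hC pS.
have Sd : forall x y, S x -> S y -> N (x - y) <= d.
  by apply/diam_leP => //; rewrite diamS.
pose A := S `|` [set p].
have diamA : diam N A = d%:E.
  apply/eqP; rewrite eq_le -{2}diamS le_diam ?andbT; last exact: subsetUl.
  apply/diam_leP => // x y [Sx|->] [Sy|->]; [exact: Sd| |exact: pS|].
    by rewrite is_norm_subC pS.
  by rewrite subrr is_norm0.
have [|M [cM AM diamM]] := exists_completion _ d0 diamA; first by exists p; right.
have hM : completion N S M.
  by split => //; [move=> x Sx; apply: AM; left|rewrite diamM diamA].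
by rewrite -(uniqC' _ hC) (uniqC' _ hM); apply: AM; right.
Qed.

(** * Antipodal points of [C] *)

Section UniqueCompletion.
Variables (S C : set 'rV[R]_n) (d : R).
Hypotheses (hlens : lens_cutting N) (d0 : 0 < d) (cS : compact S) (SC : S `<=` C)
  (Cd : forall x y, C x -> C y -> N (x - y) <= d)
  (hullC : forall p, (forall s, S s -> N (p - s) <= d) -> C p).

Lemma hull_closed : closed C.
Proof.
have -> : C = \bigcap_(s in S) [set y | N (y - s) <= d].
  by apply/seteqP; split => p; [move=> Cp s /SC; exact: Cd|exact: hullC].
by apply: closed_bigI => s _; exact: closed_norm_ball.
Qed.

Lemma hull_compact : compact C.
Proof.
apply: closed_norm_bounded_compact; first exact: hull_closed.
have [C0|C0] := pselect (C !=set0); last first.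
  by exists 0 => x Cx; exfalso; apply: C0; exists x.
have [a Ca] := C0; exists (d + N a) => x Cx.
have := norm_triangle hN (x - a) a; rewrite subrK; have := Cd Cx Ca; lra.
Qed.

(* Otherwise the lens between u and v could be cut at x without touching S. *)
Lemma antipode_unique x u v : C x -> ~ S x -> C u -> C v ->
  N (x - u) = d -> N (x - v) = d -> u = v.
Proof.
move=> Cx nSx Cu Cv xu xv; apply: contrapT => uv.
have [e e0 he] : exists2 e, 0 < e & forall s, S s -> e < N (s - x).
  have [S0|S0] := pselect (S !=set0); last first.
    by exists 1 => // s Ss; exfalso; apply: S0; exists s.
  have [a aS amin] := EVT_min_rV S0 cS (continuous_subspaceT (@is_norm_sub_continuous x)).
  have ax : 0 < N (a - x).
    rewrite lt_neqAle is_norm_ge0 andbT eq_sym; apply/eqP => /(norm_definite hN)/subr0_eq ax.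
    by apply: nSx; rewrite -ax -inE.
  by exists (N (a - x) / 2) => [|s Ss]; [lra|have := amin s (mem_set Ss); lra].
have [w xw hw] := lens_cutting_scale hlens d0 e0 uv (Cd Cu Cv) xu xv.
(* [S] avoids the [e]-ball at [x], so the [d]-ball at [w] contains [S] and [w] lies in [C], although
   [w] is farther than [d] from [x]. *)
have /(Cd Cx) : C w.
  apply: hullC => s Ss; rewrite is_norm_subC; apply: hw; last exact: he.
    by apply: Cd => //; exact: SC.
  by apply: Cd => //; exact: SC.
lra.
Qed.

(* Otherwise y could be moved away from x inside C. *)
Lemma antipode_in x y : C x -> C y -> N (x - y) = d ->
  exists2 z, S z & N (z - y) = d.
Proof.
move=> Cx Cy xy; apply: contrapT => nz.
have [z Sz|e e0 he] := @compact_point_gap S y d cS.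
  rewrite lt_neqAle Cd ?andbT //; last exact: SC.
  by apply/eqP => zy; apply: nz; exists z.
have ed0 : 0 < e / d by rewrite divr_gt0.
(* The shift has length [e], the slack between [y] and [S]: no point of [S] gets farther than [d],
   but [x] ends up at distance [d + e]. *)
pose y' := y + (e / d) *: (y - x).
have Cy' : C y'.
  apply: hullC => s Ss; rewrite /y' is_norm_subC opprD addrA.
  rewrite (le_trans (norm_triangle hN _ _))// is_normN norm_homog//.
  rewrite gtr0_norm// (is_norm_subC y x) xy divfK ?gt_eqF//.
  by have := he _ Ss; lra.
have := Cd Cx Cy'.
have -> : x - y' = (1 + e / d) *: (x - y).
  by rewrite /y' scalerDl scale1r opprD addrA -scalerN opprB.
rewrite norm_homog// xy gtr0_norm; last lra.
by rewrite mulrDl mul1r divfK ?gt_eqF//; lra.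
Qed.

(** * The part of [C] far from [S], and the extended covering *)

Lemma far_from_S r x : 0 < r -> (forall s, S s -> r <= N (x - s)) -> ~ S x.
Proof. by move=> r0 + Sx => /(_ x Sx); rewrite subrr is_norm0; lra. Qed.

Lemma far_part_compact r : compact [set x | C x /\ forall s, S s -> r <= N (x - s)].
Proof.
apply: (subclosed_compact _ hull_compact); last by move=> x [].
have -> : [set x | C x /\ forall s, S s -> r <= N (x - s)] =
    C `&` \bigcap_(s in S) [set x | r <= N (x - s)] by [].
apply: closedI; first exact: hull_closed.
by apply: closed_bigI => s _; exact: closed_norm_ballC.
Qed.

(** If far points [x] and [y] were antipodal, [x] would also have an antipode in [S]; uniqueness
    would make it equal to [y], which is far from [S]. *)
Lemma far_part_diam_gap r : 0 < r -> exists2 e, 0 < e &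
  forall x y, C x /\ (forall s, S s -> r <= N (x - s)) ->
    C y /\ (forall s, S s -> r <= N (y - s)) -> N (x - y) <= d - e.
Proof.
move=> r0; apply: (compact_diam_gap (far_part_compact (r := r))).
move=> x y [Cx xr] [Cy yr]; rewrite lt_neqAle Cd// andbT; apply/eqP => xy.
have [|z Sz zx] := antipode_in Cy Cx; first by rewrite is_norm_subC.
have yz : y = z.
  apply: (antipode_unique Cx (far_from_S r0 xr) Cy (SC Sz) xy).
  by rewrite is_norm_subC.
by apply: (far_from_S r0 yr); rewrite yz.
Qed.

(* If x has an antipode y, then z is an antipode of y in S; otherwise z is
   arbitrary. *)
Lemma far_part_cross_gap r : S !=set0 -> 0 < r -> exists2 e, 0 < e &
  forall x, C x /\ (forall s, S s -> r <= N (x - s)) ->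
    exists2 z, S z & forall q, C q -> N (q - z) <= d - r -> N (x - q) <= d - e.
Proof.
move=> [s0 Ss0] r0.
(* [T z] is meant to contain the [r]-neighbourhood in [C] of each covering member through [z]. *)
pose T z := [set q | C q /\ N (q - z) <= d - r].
have cT z : compact (T z).
  have -> : T z = C `&` [set q | N (q - z) <= d - r] by [].
  apply: (subclosed_compact _ hull_compact); last by move=> q [].
  by apply: closedI; [exact: hull_closed|exact: closed_norm_ball].
have [|e e0 he] := @compact_uniform_gap _ S T _ d (far_part_compact (r := r)).
  move=> x [Cx xr].
  (* Every antipode of [x] is one of [z], hence lies outside [T z]. *)
  have [z Sz hz] : exists2 z, S z & forall q, C q -> N (x - q) = d -> N (z - q) = d.
    have [[y Cy xy]|nxy] := pselect (exists2 y, C y & N (x - y) = d); last first.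
      by exists s0 => // q Cq xq; exfalso; apply: nxy; exists q.
    have [z Sz zy] := antipode_in Cx Cy xy; exists z => // q Cq xq.
    by rewrite -(antipode_unique Cx (far_from_S r0 xr) Cy Cq xy xq).
  have [q [Cq qz]|e e0 he] := @compact_point_gap (T z) x d (cT z).
    rewrite lt_neqAle Cd// andbT; apply/eqP => qx.
    have := hz q Cq; rewrite is_norm_subC qx is_norm_subC => /(_ erefl); lra.
  by exists z, e; split => // q /he; rewrite is_norm_subC.
by exists e => // x /he[z Sz hz]; exists z => // q Cq qz; apply: hz; split.
Qed.

(* Each member is enlarged to its r-neighbourhood in C, which covers all of C
   but the far part; a far point x joins every member that stays at distance
   at most d - e from it. A far point can join all members containing the
   point z of far_part_cross_gap. *)
Lemma hull_covering_extends k m (Q : 'I_m -> set 'rV[R]_n) r :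
  S !=set0 -> 0 < r -> (forall i, Q i `<=` S) ->
  (forall i x y, Q i x -> Q i y -> N (x - y) <= d - 3 * r) ->
  (forall x, S x -> (k <= #|[pred i | x \in Q i]|)%N) ->
  exists Q' : 'I_m -> set 'rV[R]_n,
    [/\ forall i, Q i `<=` Q' i, forall i, Q' i `<=` C,
      forall i, exists2 e, 0 < e & forall x y, Q' i x -> Q' i y -> N (x - y) <= d - e
    & forall x, C x -> (k <= #|[pred i | x \in Q' i]|)%N].
Proof.
move=> S0 r0 QS Qd Qk.
have [e1 e10 he1] := far_part_diam_gap r0.
have [e2 e20 he2] := far_part_cross_gap S0 r0.
pose K := [set x | C x /\ forall s, S s -> r <= N (x - s)].
pose Qr i := [set x | C x /\ exists2 q, Q i q & N (x - q) <= r].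
pose Q' i := Qr i `|` [set x | K x /\ forall q, Qr i q -> N (x - q) <= d - e2].
(* Each passage from [Q i] to [Qr i] costs [r]: the bound [d - 3 * r] becomes [d - 2 * r], then
   [d - r]. *)
have Qr_near i x q : Qr i x -> Q i q -> N (x - q) <= d - 2 * r.
  move=> [_ [p Qp xp]] Qq; have := is_norm_sub_triangle p x q.
  by have := Qd _ _ _ Qp Qq; lra.
have QrQr i x y : Qr i x -> Qr i y -> N (x - y) <= d - r.
  move=> Qx [_ [q Qq yq]]; have := Qr_near _ _ _ Qx Qq.
  by have := is_norm_sub_triangle q x y; rewrite (is_norm_subC q y); lra.
exists Q'; split.
- move=> i x Qx; left; split; first exact/SC/(QS i).
  by exists x => //; rewrite subrr is_norm0 ltW.
- by move=> i x [[]|[[]]].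
- move=> i; exists (Num.min r (Num.min e1 e2)); first by rewrite !lt_min r0 e10.
  have h1 : Num.min r (Num.min e1 e2) <= r by rewrite ge_min lexx.
  have h2 : Num.min r (Num.min e1 e2) <= e1 by rewrite !ge_min lexx orbT.
  have h3 : Num.min r (Num.min e1 e2) <= e2 by rewrite !ge_min lexx !orbT.
  (* The gap is [r] for two points of [Qr i], [e2] for a mixed pair and [e1] for two far points. *)
  move=> x y [Qx|[Kx hx]] [Qy|[Ky hy]].
  + by have := QrQr _ _ _ Qx Qy; lra.
  + by have := hy _ Qx; rewrite is_norm_subC; lra.
  + by have := hx _ Qy; lra.
  + by have := he1 _ _ Kx Ky; lra.
- move=> x Cx.
  suff [z Sz hz] : exists2 z, S z & forall i, Q i z -> Q' i x.
    apply: leq_trans (Qk z Sz) _; apply/subset_leq_card/fintype.subsetP => i.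
    by rewrite !inE => /hz.
  have [Kx|nKx] := pselect (K x).
    have [z Sz hz] := he2 _ Kx; exists z => // i Qz; right; split => // q Qq.
    apply: hz; first by case: Qq.
    by have := Qr_near _ _ _ Qq Qz; lra.
  have [s Ss sx] : exists2 s, S s & N (x - s) < r.
    apply: contrapT => ns; apply: nKx; split => // s Ss; rewrite leNgt.
    by apply/negP => xs; apply: ns; exists s.
  by exists s => // i Qs; left; split => //; exists s => //; exact: ltW.
Qed.

End UniqueCompletion.

End Norm.

Theorem theorem1 (R : realType) (n : nat) (N : 'rV[R]_n -> R)
  (hN : is_norm N) (hlens : lens_cutting N)
  (k : nat) (hk : (0 < k)%N)
  (S C : set 'rV[R]_n)
  (hclosed : closed S) (hdiam : (0 < diam N S)%E)
  (huniq : unique_completion N S) (hC : completion N S C)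
  (m : nat) (Q : 'I_m -> set 'rV[R]_n) (hQ : borsuk_covering N k S Q) :
  covering_extends N k C Q.
Proof.
have [bS _] := huniq; have [_ SC diamC] := hC; have [QS Qdiam Qk] := hQ.
have [d diamS] : exists d, diam N S = d%:E.
  exists (fine (diam N S)); rewrite fineK// ge0_fin_numE ?ltW//.
  exact: norm_bounded_diam.
have d0 : 0 < d by rewrite -lte_fin -diamS.
have Cd : forall x y, C x -> C y -> N (x - y) <= d.
  by apply/diam_leP; rewrite ?diamC ?diamS// ltW.
have S0 : S !=set0.
  apply: contrapT => nS; move: hdiam; rewrite ltNge => /negP; apply.
  by apply/diam_leP => // x y Sx; exfalso; apply: nS; exists x.
(* A third of each member's slack would do; finiteness of the family allows a common [r]. *)
have [r r0 hr] : exists2 r, 0 < r &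
    forall i x y, Q i x -> Q i y -> N (x - y) <= d - 3 * r.
  have : \forall r \near (0:R)^'+, 0 < r /\
      forall i x y, Q i x -> Q i y -> N (x - y) <= d - 3 * r.
    apply: filterI; first exact: nbhs_right_gt.
    apply: (@filter_forall _ _ (fun i => [set r | forall x y, Q i x -> Q i y -> N (x - y) <= d - 3 * r]) (0:R)^'+) => i.
    have := Qdiam i; rewrite diamS => /(diam_ltP _ _ d0)[e e0 he].
    have e30 : 0 < e / 3 by rewrite divr_gt0.
    near=> r => x y Qx Qy.
    have : r <= e / 3 by near: r; exact: nbhs_right_le.
    by have := he _ _ Qx Qy; lra.
  by move=> /filter_ex[r [r0 hr]]; exists r.
have hull p : (forall s, S s -> N (p - s) <= d) -> C p.
  by apply: (unique_completion_hull hN (ltW d0) diamS).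
have [Q' [QQ' Q'C Q'd Q'k]] := hull_covering_extends hN hlens d0
  (closed_norm_bounded_compact hN hclosed bS) SC Cd hull S0 r0 QS hr Qk.
exists Q'; split => //; split => // i.
by rewrite diamC diamS; apply/diam_ltP.
Unshelve. all: by end_near. Qed.
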